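(* Let $A\subset\mathbb{R}^n$ be a nonempty closed set, and let $r\colon\mathrm{bdry}\,A\to(0,+\infty]$ be a continuous function. Then the following assertions are equivalent: (i) $A$ satisfies the extended exterior $r(\cdot)$-sphere condition. (ii) $A$ is $\bar A^{r}$-convex. (iii) $A$ is $\bar A_{r}$-convex, every $x\in\bar A_r$ with $x\in\mathrm{bdry}\,\bar A_r$ is such that $\mathrm{proj}_A(x)$ is a singleton, and the set $\mathcal{O}$ is open.
   Context: $\mathbb{R}^n$ carries the Euclidean norm $\|\cdot\|$ and inner product $\langle\cdot,\cdot\rangle$. $X^c$, $\mathrm{int}\,X$, $\mathrm{bdry}\,X$ denote complement in $\mathbb{R}^n$, interior and boundary. $B(y;\sigma)$ is the open ball with center $y$ and radius $\sigma>0$. $\mathrm{proj}_A(x)$ is the set of points of $A$ closest to $x$. $[x,y]$ is the closed segment joining $x$ and $y$. Continuity of $r$ is as a map into the extended half-line $(0,+\infty]$. Proximal normal cone: for $A$ nonempty and closed and $a\in A$, $N^P_A(a)$ is the set of $\zeta\in\mathbb{R}^n$ for which there is $\sigma\ge0$ with $\langle\zeta,x-a\rangle\le\sigma\|x-a\|^2$ for all $x\in A$. For $a\in\mathrm{bdry}\,A$ and $\rho>0$, a unit vector $\zeta\in N^P_A(a)$ is realized by a $\rho$-sphere if $B(a+\rho\zeta;\rho)\cap A=\emptyset$. Extended exterior $r(\cdot)$-sphere condition: for every $a\in\mathrm{bdry}\,A$: - if $a\in\mathrm{bdry}(\mathrm{int}\,A)$, then there exists a unit vector $\zeta_a\in N^P_A(a)$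 which is realized by an $r(a)$-sphere if $r(a)<+\infty$, and by a $\rho$-sphere for all $\rho>0$ if $r(a)=+\infty$; - if $a\notin\mathrm{bdry}(\mathrm{int}\,A)$, then every unit vector $\zeta_a\in N^P_A(a)$ is realized by an $r(a)$-sphere if $r(a)<+\infty$, and by a $\rho$-sphere for all $\rho>0$ if $r(a)=+\infty$. $S$-convexity: let $A\subset\mathbb{R}^n$ be nonempty and closed and let $S\supset A$. $A$ is $S$-convex if for all $s\in S\cap A^c$ and all $a\ne a'$ in $\mathrm{bdry}\,A$ with $[a,s]\subset S$ and $[a',s]\subset S$, one has $(s-a)\notin N^P_A(a)$ or $(s-a')\notin N^P_A(a')$. For $a\in\mathrm{bdry}\,A$ and a unit vector $\zeta\in N^P_A(a)$, define: - $\rho(a,\zeta):=\max\{\rho : \zeta\text{ is realized by a }\rho\text{-sphere}\}\in(0,+\infty]$ (equal to $+\infty$ if $\zeta$ is realized by a $\rho$-sphere for all $\rho>0$); - $\rho(a,\zeta,r):=\max\{\rho:\rho\le r(a)\text{ and }\zeta\text{ is realized by a }\rho\text{-sphere}\}=\min\{\rho(a,\zeta),r(a)\}$. Define further: - $A^{UP}:=\{x\in A^c : \mathrm{proj}_A(x)=\{a\}\text{ for some }a,\text{ and }\|x-a\|<\rho(a,\frac{x-a}{\|x-a\|})\}$; - $A_{UP(r)}:=\{x\in A^c : \mathrm{proj}_A(x)=\{a\}\text{ for some }a,\text{ and }\|x-a\|<\rho(a,\frac{x-a}{\|x-a\|},r)\}$; - $\mathrm{bdry}_r(\mathrm{int}\,A):=\{a\in\mathrm{bdry}(\mathrm{int}\,A):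 \exists\,\zeta\in N^P_A(a)\text{ unit with }\rho(a,\zeta)\ge r(a)\}$; - $\mathcal{O}:=\{x\in A^c : \exists\, a\in\mathrm{proj}_A(x)\cap[\mathrm{bdry}(\mathrm{int}\,A)]^c\text{ with }\|x-a\|<r(a)\}$; - $\mathcal{P}:=\{x\in A^c : \mathrm{proj}_A(x)\cap\mathrm{bdry}(\mathrm{int}\,A)\not\subset\mathrm{bdry}_r(\mathrm{int}\,A)\}$; - $\bar A_r:=A\cup A_{UP(r)}\cup\mathcal{O}\cup\mathcal{P}$; - $\bar A^r:=A\cup A^{UP}\cup\mathcal{O}\cup\mathcal{P}$. *)

(* Defs.v *)
From HB Require Import structures.
From mathcomp Require Import all_boot all_order all_algebra.
From mathcomp Require Import all_classical all_reals all_analysis.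

Set Implicit Arguments.
Unset Strict Implicit.
Unset Printing Implicit Defensive.

Import Order.TTheory GRing.Theory Num.Theory.
Import numFieldNormedType.Exports.

Local Open Scope classical_set_scope.
Local Open Scope ring_scope.

(* The library norm [`|x|] on ['rV[R]_n] is the sup norm, so the Euclidean
   norm and its balls are defined here.  Open sets, closures, interiors and
   continuity are those of the library topology on ['rV[R]_n], which is also
   the Euclidean topology. *)

Section ProximalGeometry.
Context {R : realType} {n : nat}.
Implicit Types (A S : set 'rV[R]_n) (a x y u v z : 'rV[R]_n) (r : 'rV[R]_n -> \bar R).

Definition dotp u v : R := \sum_(i < n) u 0 i * v 0 i.

Definition enorm u : R := Num.sqrt (dotp u u).

Definition eball y (s : R) : set 'rV[R]_n := [set x | enorm (x - y) < s].

Definition segm x y : set 'rV[R]_n :=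
  [set (1 - t) *: x + t *: y | t in [set t : R | 0 <= t <= 1]].

Definition bdry A : set 'rV[R]_n := closure A `\` interior A.

Definition projset A x : set 'rV[R]_n :=
  [set a | A a /\ forall b, A b -> enorm (x - a) <= enorm (x - b)].

Definition prox_normal A a : set 'rV[R]_n :=
  [set z | exists2 s : R, 0 <= s &
     forall x, A x -> dotp z (x - a) <= s * enorm (x - a) ^+ 2].

Definition unit_prox_normal A a : set 'rV[R]_n :=
  [set z | prox_normal A a z /\ enorm z = 1].

Definition realized A a z (p : R) : Prop :=
  eball (a + p *: z) p `&` A = set0.

(* The value [-oo] never occurs for a radius in (0, +oo]. *)
Definition realized_ext A a z (e : \bar R) : Prop :=
  match e with
  | p%:E%E => realized A a z p
  | +oo%E => forall p : R, 0 < p -> realized A a z p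
  | -oo%E => False
  end.

(* A function r : bdry A -> (0, +oo] is represented by a total function; only
   its values on [bdry A] are ever used. *)
Definition ext_exterior_sphere A r : Prop :=
  forall a, bdry A a ->
    (bdry (interior A) a ->
       exists2 z, unit_prox_normal A a z & realized_ext A a z (r a)) /\
    (~ bdry (interior A) a ->
       forall z, unit_prox_normal A a z -> realized_ext A a z (r a)).

(* To be used for A nonempty and closed, and A `<=` S. *)
Definition S_convex S A : Prop :=
  forall s, S s -> ~ A s ->
  forall a a', bdry A a -> bdry A a' -> a <> a' ->
    segm a s `<=` S -> segm a' s `<=` S ->
    ~ prox_normal A a (s - a) \/ ~ prox_normal A a' (s - a').

(* For a unit proximal normal the set of radii is nonempty, and the supremum is
   a maximum when it is finite: the balls increase with the radius. *)
Definition rho A a z : \bar R :=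
  ereal_sup [set p%:E | p in [set p : R | 0 < p /\ realized A a z p]].

Definition rho_r A r a z : \bar R :=
  ereal_sup [set p%:E | p in
    [set p : R | [/\ 0 < p, (p%:E <= r a)%E & realized A a z p]]].

Definition normalized u : 'rV[R]_n := (enorm u)^-1 *: u.

Definition UPset A : set 'rV[R]_n :=
  [set x | ~ A x /\ exists a, projset A x = [set a] /\
     ((enorm (x - a))%:E < rho A a (normalized (x - a)))%E].

Definition UPset_r A r : set 'rV[R]_n :=
  [set x | ~ A x /\ exists a, projset A x = [set a] /\
     ((enorm (x - a))%:E < rho_r A r a (normalized (x - a)))%E].

Definition bdry_r_int A r : set 'rV[R]_n :=
  [set a | bdry (interior A) a /\
     exists2 z, unit_prox_normal A a z & (r a <= rho A a z)%E].

Definition Oset A r : set 'rV[R]_n :=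
  [set x | ~ A x /\ exists a, [/\ projset A x a, ~ bdry (interior A) a &
     ((enorm (x - a))%:E < r a)%E]].

Definition Pset A r : set 'rV[R]_n :=
  [set x | ~ A x /\ ~ (projset A x `&` bdry (interior A) `<=` bdry_r_int A r)].

Definition Abar_lower A r : set 'rV[R]_n :=
  A `|` UPset_r A r `|` Oset A r `|` Pset A r.

Definition Abar_upper A r : set 'rV[R]_n :=
  A `|` UPset A `|` Oset A r `|` Pset A r.

End ProximalGeometry.

(* Main.v *)
(* Write rho(a, z) for the largest radius of a ball realizing the unit normal
   [z] at [a].

   Points at distance < rho(a, z) from [a] on the ray of [z] project onto [a]
   only, so, walking from a boundary point [a] to [s] along a normal inside
   A u A^UP, one never reaches distance rho(a, z): [a] is the unique projection
   of [s], and A is (A u A^UP)-convex for every closed A.  Under the sphere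
   condition P is empty and O lies in A^UP, which gives (i) => (ii) and
   (i) => (iii).

   Conversely, let S be one of the two enlargements.  From every point of S
   outside A some segment to a projection stays in S.  If rho(a, z) < r(a), the
   ray from [a] up to x = a + rho(a, z) z lies in O or in P, hence in S; if [x]
   is interior to S, the points slightly beyond [x] lie in S and project
   elsewhere than on [a], which contradicts S-convexity.  If [a] is not in
   bdry(int A), then [x] is interior because O is open.  Otherwise no unit
   normal at [a] is realized by an r(a)-sphere, a property that persists at
   nearby boundary points by lower semicontinuity of r and compactness of the
   unit sphere; were [x] on the boundary of S, its projection would be unique,
   the projections of the points near [x] would be near [a], and those points
   would all lie in O or P, making [x] interior.  If [a] has no unit normal at
   all, the argument is applied at a nearby boundary point that is the
   projection of some point outside A. *)
Require Import Defs.
From HB Require Import structures.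
From mathcomp Require Import all_boot all_order all_algebra.
From mathcomp Require Import all_classical all_reals all_analysis.
From mathcomp Require Import ring lra.
Set Implicit Arguments.
Unset Strict Implicit.
Unset Printing Implicit Defensive.

Import Order.TTheory GRing.Theory Num.Theory.
Import numFieldNormedType.Exports.
Local Open Scope classical_set_scope.
Local Open Scope ring_scope.

(** * Euclidean inner product and norm, and their link with the sup-norm topology *)

Section EuclideanSpace.
Context {R : realType} {n : nat}.
Implicit Types (u v w x y a : 'rV[R]_n) (A U : set 'rV[R]_n) (c e t : R).

Lemma dotpC u v : dotp u v = dotp v u.
Proof. by apply: eq_bigr => i _; rewrite mulrC. Qed.

Lemma dotpDl u v w : dotp (u + v) w = dotp u w + dotp v w.
Proof. by rewrite -big_split/=; apply: eq_bigr => i _; rewrite mxE mulrDl. Qed.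

Lemma dotpZl c u v : dotp (c *: u) v = c * dotp u v.
Proof. by rewrite mulr_sumr; apply: eq_bigr => i _; rewrite mxE mulrA. Qed.

Lemma dotpDr u v w : dotp u (v + w) = dotp u v + dotp u w.
Proof. by rewrite dotpC dotpDl !(dotpC u). Qed.

Lemma dotpZr c u v : dotp u (c *: v) = c * dotp u v.
Proof. by rewrite dotpC dotpZl dotpC. Qed.

Lemma dotpNl u v : dotp (- u) v = - dotp u v.
Proof. by rewrite -scaleN1r dotpZl mulN1r. Qed.

Lemma dotpNr u v : dotp u (- v) = - dotp u v.
Proof. by rewrite dotpC dotpNl dotpC. Qed.

Lemma sqr_coord_le_dotp u i : u 0 i ^+ 2 <= dotp u u.
Proof.
rewrite /dotp (bigD1 i)//= expr2 lerDl.
by apply: sumr_ge0 => j _; rewrite -expr2 sqr_ge0.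
Qed.

Lemma dotp_ge0 u : 0 <= dotp u u.
Proof. by apply: sumr_ge0 => i _; rewrite -expr2 sqr_ge0. Qed.

Lemma enorm_ge0 u : 0 <= enorm u. Proof. exact: sqrtr_ge0. Qed.

Lemma sqr_enorm u : enorm u ^+ 2 = dotp u u.
Proof. by rewrite sqr_sqrtr// dotp_ge0. Qed.

Lemma enorm_eq0 u : enorm u = 0 -> u = 0.
Proof.
move=> u0; apply/rowP => i; rewrite mxE; apply/eqP; rewrite -sqrf_eq0 eq_le.
by rewrite sqr_ge0 andbT (le_trans (sqr_coord_le_dotp u i))// -sqr_enorm u0 expr0n.
Qed.

Lemma enorm0 : enorm (0 : 'rV[R]_n) = 0.
Proof. by rewrite /enorm -(scale0r 0) dotpZl mul0r sqrtr0. Qed.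

Lemma enormZ c u : enorm (c *: u) = `|c| * enorm u.
Proof.
by rewrite /enorm dotpZl dotpZr mulrA -expr2 sqrtrM ?sqr_ge0// sqrtr_sqr.
Qed.

Lemma enormB u v : enorm (u - v) = enorm (v - u).
Proof. by rewrite -opprB -scaleN1r enormZ normrN1 mul1r. Qed.

Lemma ltr_enorm u c : 0 <= c -> (enorm u < c) = (dotp u u < c ^+ 2).
Proof. by move=> c0; rewrite -sqr_enorm ltr_pXn2r// nnegrE// enorm_ge0. Qed.

Lemma enorm_gt0 u : u <> 0 -> 0 < enorm u.
Proof.
by move=> u0; rewrite lt_neqAle enorm_ge0 andbT eq_sym; apply/eqP => /enorm_eq0.
Qed.

Lemma enorm_normalized u : u <> 0 -> enorm (normalized u) = 1.
Proof.
move=> /enorm_gt0 u0; rewrite enormZ ger0_norm ?invr_ge0 ?enorm_ge0//.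
by rewrite mulVf// gt_eqF.
Qed.

Lemma scale_normalized u : enorm u *: normalized u = u.
Proof.
have [->|/eqP/enorm_gt0 u0] := eqVneq u 0; first by rewrite /normalized !scaler0.
by rewrite scalerA divff ?scale1r// gt_eqF.
Qed.

Lemma normalizedZ t u : 0 < t -> enorm u = 1 -> normalized (t *: u) = u.
Proof.
move=> t0 u1; rewrite /normalized enormZ u1 mulr1 gtr0_norm// scalerA.
by rewrite mulVf ?scale1r// gt_eqF.
Qed.

(** Through this inequality Euclidean balls lie inside sup-norm balls of the same radius, and
    Euclidean-bounded sets are bounded. *)
Lemma norm_le_enorm u : `|u| <= enorm u.
Proof.
rewrite [`|u|]mx_normrE; apply: bigmax_le => [|[i j] _ /=]; first exact: enorm_ge0.
rewrite -sqrtr_sqr ler_wsqrtr// (ord1 i); exact: sqr_coord_le_dotp.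
Qed.

Lemma cvg_dotp {T : Type} (F : set_system T) {FF : Filter F}
    (f g : T -> 'rV[R]_n) u v :
  f @ F --> u -> g @ F --> v -> dotp (f k) (g k) @[k --> F] --> dotp u v.
Proof.
move=> fu gv; apply: (cvg_big (@add_continuous R) (Ff := fun i k => f k 0 i * g k 0 i)
  (Fa := fun i => u 0 i * v 0 i)) => i _.
by apply: cvgM; [apply: (cvg_comp f (fun z : 'rV[R]_n => z 0 i) fu)
  | apply: (cvg_comp g (fun z : 'rV[R]_n => z 0 i) gv)]; exact: coord_continuous.
Qed.

Lemma cvg_enorm {T : Type} (F : set_system T) {FF : Filter F}
    (f : T -> 'rV[R]_n) u :
  f @ F --> u -> enorm (f k) @[k --> F] --> enorm u.
Proof.
by move=> fu; exact: (cvg_comp _ _ (cvg_dotp fu fu) (@sqrt_continuous R _)).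
Qed.

Lemma nbhs_eball_sub x U : nbhs x U -> exists2 e, 0 < e & eball x e `<=` U.
Proof.
move=> /nbhs_ballP[e/= e0 eU]; exists e => // y xy; apply: eU.
by rewrite -ball_normE/= distrC (le_lt_trans (norm_le_enorm _)).
Qed.

Lemma closed_enorm_le_compact A c :
  closed A -> (forall x, A x -> enorm x <= c) -> compact A.
Proof.
move=> Acl Ac; apply: bounded_closed_compact => //.
exists c; split; first exact: num_real.
by move=> d /ltW cd x /Ac xc; rewrite /= (le_trans (norm_le_enorm x))// (le_trans xc).
Qed.

Lemma unit_sphere_compact : compact [set z : 'rV[R]_n | enorm z = 1].
Proof.
apply: (@closed_enorm_le_compact _ 1) => [|z ->//].
apply: (@closed_comp _ _ (@enorm R n) [set 1]); last exact: closed_eq.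
by move=> z _; exact: (cvg_enorm (f := id) (@cvg_id _ (nbhs z))).
Qed.

End EuclideanSpace.

(** * Balls realizing proximal normals, and points on normal rays *)

Section Spheres.
Context {R : realType} {n : nat}.
Implicit Types (A S U : set 'rV[R]_n) (a b x y z : 'rV[R]_n) (p q t : R)
  (r : 'rV[R]_n -> \bar R).

Lemma enorm_ray a z t : enorm z = 1 -> 0 <= t -> enorm (a + t *: z - a) = t.
Proof. by move=> z1 t0; rewrite addrC addKr enormZ z1 mulr1 ger0_norm. Qed.

(** Expanding the squared distance from [b] to the centre, the terms in [p ^+ 2] cancel because [z]
    is a unit vector. The remaining condition is linear in [p], so radii are easy to compare and to
    pass to the limit. *)
Lemma realizedP A a z p : enorm z = 1 -> 0 <= p ->
  realized A a z p <->
  forall b, A b -> 2 * p * dotp z (b - a) <= dotp (b - a) (b - a).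
Proof.
move=> z1 p0.
have E b : (enorm (b - (a + p *: z)) < p) =
    (dotp (b - a) (b - a) < 2 * p * dotp z (b - a)).
  rewrite ltr_enorm// opprD addrA !(dotpDl, dotpDr, dotpNl, dotpNr, dotpZl, dotpZr).
  rewrite -[dotp z z]sqr_enorm z1 (dotpC b z) (dotpC a z).
  by apply/idP/idP => ?; lra.
split=> [/seteqP[rA _] b Ab|rA]; last apply/seteqP; last split=> // b [+ Ab].
  by rewrite leNgt -E; apply/negP => H; exact: (rA b).
by rewrite /eball/= E ltNge rA.
Qed.

Lemma realized_le A a z p q : enorm z = 1 -> 0 <= p -> p <= q ->
  realized A a z q -> realized A a z p.
Proof.
move=> z1 p0 pq /(realizedP A a z1 (le_trans p0 pq)) rq; apply/realizedP => // b Ab.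
have [zb|zb] := leP (dotp z (b - a)) 0; last first.
  by rewrite (le_trans _ (rq b Ab))// ler_wpM2r ?(ltW zb)// ler_wpM2l.
by rewrite (le_trans _ (dotp_ge0 _))// mulr_ge0_le0 ?mulr_ge0.
Qed.

Lemma realized_notin A a z p : enorm z = 1 -> 0 < p -> realized A a z p ->
  ~ A (a + p *: z).
Proof.
move=> z1 p0 /seteqP[rA _] Aap; apply: (rA (a + p *: z)); split=> //.
by rewrite /eball/= subrr enorm0.
Qed.

Lemma projset_ray A a z t : enorm z = 1 -> 0 <= t ->
  projset A (a + t *: z) a <-> A a /\ realized A a z t.
Proof.
move=> z1 t0; split=> [[Aa pa]|[Aa /seteqP[rA _]]]; split=> //.
  apply/seteqP; split=> // b [+ /pa]; rewrite enorm_ray// enormB /eball/=.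
  by rewrite ltNge => /negP.
move=> b Ab; rewrite enorm_ray// leNgt; apply/negP => bt; apply: (rA b).
by split=> //; rewrite /eball/= enormB.
Qed.

Lemma projset_ray_uniq A a z t q : enorm z = 1 -> A a -> 0 <= t -> t < q ->
  realized A a z q -> projset A (a + t *: z) = [set a].
Proof.
move=> z1 Aa t0 tq rq; have q0 : 0 <= q by lra.
apply/seteqP; split=> [b [Ab /(_ a Aa)]|_ ->/=]; last first.
  by apply/projset_ray => //; split=> //; apply: realized_le rq => //; exact: ltW.
rewrite enorm_ray// => bt; apply/subr0_eq/enorm_eq0/eqP; rewrite -sqrf_eq0 sqr_enorm.
have {bt} : dotp (b - a) (b - a) <= 2 * t * dotp z (b - a).
  have : enorm (a + t *: z - b) ^+ 2 <= t ^+ 2 by rewrite lerXn2r ?nnegrE ?enorm_ge0.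
  rewrite sqr_enorm !(dotpDl, dotpDr, dotpNl, dotpNr, dotpZl, dotpZr).
  rewrite -[dotp z z]sqr_enorm z1 (dotpC b z) (dotpC a z) (dotpC b a); lra.
have := (realizedP A a z1 q0).1 rq b Ab; have := dotp_ge0 (b - a).
(* Here [2 * q * s <= d <= 2 * t * s] with [0 <= t < q], so [s <= 0] and hence [d = 0]. *)
move: (dotp z _) (dotp (b - a) _) => s d d0 sq st.
rewrite eq_le d0 andbT; nra.
Qed.

Lemma projset_dir A x a : ~ A x -> projset A x a -> exists z t,
  [/\ A a, enorm z = 1, 0 < t, realized A a z t & x = a + t *: z].
Proof.
move=> nAx pa; have Aa := pa.1.
have xa : x - a <> 0 by move/subr0_eq => xa; apply: nAx; rewrite xa.
have xE : x = a + enorm (x - a) *: normalized (x - a).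
  by rewrite scale_normalized addrC subrK.
have z1 := enorm_normalized xa; have t0 := enorm_gt0 xa.
exists (normalized (x - a)), (enorm (x - a)); split=> //.
by move: pa; rewrite {1}xE => /(projset_ray A a z1 (ltW t0)).1[].
Qed.

(** The points [a + t *: z] with small [t] are centres of smaller empty balls, so they lie outside
    [A] while tending to [a]. *)
Lemma realized_bdry A a z p : A a -> enorm z = 1 -> 0 < p -> realized A a z p ->
  bdry A a.
Proof.
move=> Aa z1 p0 rp; split; first exact: subset_closure.
move=> /nbhs_eball_sub[e e0 eA]; pose t := Num.min (e / 2) p.
have t0 : 0 < t by rewrite lt_min p0 andbT divr_gt0.
apply: (@realized_notin A a z t) => //.
  by apply: realized_le rp => //; [exact: ltW|rewrite ge_min lexx orbT].
apply: eA; rewrite /eball/= enorm_ray ?(ltW t0)// (le_lt_trans (y := e / 2))//.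
  by rewrite ge_min lexx.
by lra.
Qed.

Lemma projset_bdry A x a : ~ A x -> projset A x a -> bdry A a.
Proof.
by move=> nAx /(projset_dir nAx)[z [t [Aa z1 t0 rt _]]]; exact: realized_bdry rt.
Qed.

(** A radius [p] corresponds to the constant [1 / (2 p)] in the proximal inequality. *)
Lemma prox_normal_realizedP A a z : enorm z = 1 ->
  prox_normal A a z <-> exists2 p, 0 < p & realized A a z p.
Proof.
move=> z1; split=> [[s s0 zs]|[p p0 rp]].
  (* Taking [s + 1] instead of [s] covers the case [s = 0]. *)
  have s1 : 0 < 2 * (s + 1) by lra.
  exists (2 * (s + 1))^-1; first by rewrite invr_gt0.
  apply/realizedP => // [|b Ab]; first by rewrite ltW// invr_gt0.
  have := zs _ Ab; rewrite sqr_enorm; have := dotp_ge0 (b - a).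
  move: (dotp z _) (dotp (b - a) _) => c d d0 cd.
  have -> : 2 * (2 * (s + 1))^-1 * c = c / (s + 1) by field; lra.
  by rewrite ler_pdivrMr; nra.
exists (2 * p)^-1; first by rewrite invr_ge0; lra.
move=> b Ab; rewrite sqr_enorm mulrC ler_pdivlMr ?mulr_gt0// mulrC.
exact: (realizedP A a z1 (ltW p0)).1.
Qed.

Lemma prox_normalZ A a z t : 0 <= t -> prox_normal A a z ->
  prox_normal A a (t *: z).
Proof.
move=> t0 [s s0 zs]; exists (t * s); first exact: mulr_ge0.
by move=> x Ax; rewrite dotpZl -mulrA ler_wpM2l// zs.
Qed.

Lemma prox_normal_ray A a z p t : enorm z = 1 -> 0 < p -> realized A a z p ->
  0 <= t -> prox_normal A a (a + t *: z - a).
Proof.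
move=> z1 p0 rp t0; rewrite addrAC subrr add0r; apply: prox_normalZ => //.
by apply/prox_normal_realizedP => //; exists p.
Qed.

Lemma realized_ext_gt0 A a z (e : \bar R) : (0 < e)%E -> realized_ext A a z e ->
  exists2 p, 0 < p & realized A a z p.
Proof.
case: e => [p||] //= e0 rA; first by exists p => //; rewrite -lte_fin.
by exists 1 => //; exact: rA.
Qed.

(** The balls are open, so a finite radius is realized as soon as all smaller ones are; finite and
    infinite [e] can then be treated alike. *)
Lemma realized_extP A a z (e : \bar R) : enorm z = 1 -> (0 < e)%E ->
  realized_ext A a z e <->
  forall p, 0 < p -> (p%:E < e)%E -> realized A a z p.
Proof.
move=> z1; case: e => [p||] //= p0; last first.
  by split=> rA q q0; [move=> _; exact: rA | apply: rA => //; exact: ltry].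
rewrite lte_fin in p0; split=> [rp q q0|rA].
  by rewrite lte_fin => qp; apply: realized_le rp => //; exact: ltW.
apply/realizedP => // [|b Ab]; first exact: ltW.
have [zb|zb] := leP (dotp z (b - a)) 0.
  by rewrite (le_trans _ (dotp_ge0 _))// mulr_ge0_le0// mulr_ge0// ltW.
rewrite -ler_pdivlMr// mulrC -ler_pdivlMr//; rewrite leNgt.
(* [M] is the largest radius that the point [b] allows; if [M < p], the midpoint [q] is a radius
   below [p] that [b] forbids. *)
set M := _ / 2; apply/negP => Mp; pose q := (M + p) / 2.
have M0 : 0 <= M by rewrite !divr_ge0 ?dotp_ge0// ltW.
have q0 : 0 < q by rewrite /q; lra.
have qp : (q%:E < p%:E)%E by rewrite lte_fin /q; lra.
have := (realizedP A a z1 (ltW q0)).1 (rA q q0 qp) b Ab.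
by rewrite -ler_pdivlMr// mulrC -ler_pdivlMr// -/M /q => ?; lra.
Qed.

(** Failure at [e] provides an unrealized radius below [e]. It bounds the realized radii, and their
    supremum is itself realized by [realized_extP]. *)
Lemma max_radius A a z (e : \bar R) : (0 < e)%E -> unit_prox_normal A a z ->
  ~ realized_ext A a z e ->
  exists p, [/\ 0 < p, (p%:E < e)%E, realized A a z p
    & forall q, p < q -> ~ realized A a z q].
Proof.
move=> e0 [za z1] nre.
have [q [q0 qe nrq]] : exists q, [/\ 0 < q, (q%:E < e)%E & ~ realized A a z q].
  apply: contrapT => nq; apply/nre/realized_extP => // q q0 qe.
  by apply: contrapT => nrq; apply: nq; exists q.
have [p0 p00 rp0] := (prox_normal_realizedP A a z1).1 za.
pose E := [set p | 0 < p /\ realized A a z p].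
have Eub p : E p -> p <= q.
  move=> [p1 rp]; rewrite leNgt; apply/negP => /ltW qp.
  by apply/nrq/realized_le/rp => //; exact: ltW.
have supE : has_sup E by split; [exists p0 | exists q => p; exact: Eub].
have s0 : 0 < sup E by rewrite (lt_le_trans p00)// sup_upper_bound.
exists (sup E); split=> //.
- by rewrite (le_lt_trans _ qe)// lee_fin ge_sup//; exists p0.
- apply/(@realized_extP A a z (sup E)%:E z1); rewrite ?lte_fin// => t t0.
  rewrite lte_fin => ts.
  have [p [p1 rp]] := sup_adherent (etrans (subr_gt0 _ _) ts) supE.
  by rewrite opprB addrC subrK => /ltW tp; apply: realized_le rp => //; exact: ltW.
- move=> t st rt; suff : t <= sup E by rewrite leNgt st.
  by apply: sup_upper_bound => //; split=> //; lra.
Qed.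

Lemma segm_ray S a z t : 0 < t ->
  segm a (a + t *: z) `<=` S <-> forall c, 0 <= c -> c <= t -> S (a + c *: z).
Proof.
move=> t0; split=> [aS c c0 ct|aS _ [c /andP[c0 c1] <-]].
  apply: aS; exists (c / t).
    by rewrite /= divr_ge0 ?(ltW t0)//= ler_pdivrMr// mul1r.
  rewrite scalerDr addrA -scalerDl subrK scale1r scalerA divfK// gt_eqF//.
rewrite scalerDr addrA -scalerDl subrK scale1r scalerA.
by apply: aS; [rewrite mulr_ge0// ltW | rewrite ler_piMl// ltW].
Qed.

(** Being strictly below the supremum [rho] amounts to having a realized radius [q > t], and such a
    [q] already forces the projection to be unique. *)
Lemma UPsetP A x : UPset A x <-> exists a z t q,
  [/\ A a /\ enorm z = 1, 0 < t, t < q, realized A a z q & x = a + t *: z].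
Proof.
split=> [[nAx [a [pa]]]|[a [z [t [q [[Aa z1] t0 tq rq ->]]]]]].
  have /(projset_dir nAx)[z [t [Aa z1 t0 rt ->]]] : projset A x a by rewrite pa.
  rewrite enorm_ray ?(ltW t0)// addrAC subrr add0r normalizedZ// => /ereal_sup_gt.
  by move=> [_ [q [q0 rq] <-]]; rewrite lte_fin => tq; exists a, z, t, q.
split; first by apply: realized_notin => //; apply: realized_le rq => //; exact: ltW.
exists a; split; first exact: projset_ray_uniq (ltW t0) tq rq.
rewrite enorm_ray ?(ltW t0)// addrAC subrr add0r normalizedZ//.
rewrite (lt_le_trans (y := q%:E)) ?lte_fin//; apply: ereal_sup_ubound.
by exists q => //; split=> //; lra.
Qed.

Lemma UPset_rP A r x : UPset_r A r x <-> exists a z t q,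
  [/\ A a /\ enorm z = 1, 0 < t /\ t < q, (q%:E <= r a)%E,
      realized A a z q & x = a + t *: z].
Proof.
split=> [[nAx [a [pa]]]|[a [z [t [q [[Aa z1] [t0 tq] qr rq ->]]]]]].
  have /(projset_dir nAx)[z [t [Aa z1 t0 rt ->]]] : projset A x a by rewrite pa.
  rewrite enorm_ray ?(ltW t0)// addrAC subrr add0r normalizedZ// => /ereal_sup_gt.
  by move=> [_ [q [q0 qr rq] <-]]; rewrite lte_fin => tq; exists a, z, t, q.
split; first by apply: realized_notin => //; apply: realized_le rq => //; exact: ltW.
exists a; split; first exact: projset_ray_uniq (ltW t0) tq rq.
rewrite enorm_ray ?(ltW t0)// addrAC subrr add0r normalizedZ//.
rewrite (lt_le_trans (y := q%:E)) ?lte_fin//; apply: ereal_sup_ubound.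
by exists q => //; split=> //; lra.
Qed.

Lemma rho_ge_realized_ext A a z (e : \bar R) : enorm z = 1 -> (0 < e)%E ->
  (e <= rho A a z)%E <-> realized_ext A a z e.
Proof.
move=> z1 e0; split=> [er|].
  apply/realized_extP => // p p0 /lt_le_trans/(_ er)/ereal_sup_gt.
  move=> [_ [q [q0 rq] <-]]; rewrite lte_fin => /ltW pq.
  by apply: realized_le rq => //; exact: ltW.
move: e0; case: e => [p||] //=.
  by rewrite lte_fin => p0 rp; apply: ereal_sup_ubound; exists p.
move=> _ rA; rewrite leye_eq; apply/eqP/eqyP => p p0.
by apply: ereal_sup_ubound; exists p => //; split=> //; exact: rA.
Qed.

End Spheres.

(** * Existence and upper semicontinuity of the projection *)

Section Projections.
Context {R : realType} {n : nat}.
Implicit Types (A S U : set 'rV[R]_n) (a b x y z : 'rV[R]_n) (p q t : R).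

Lemma cvg_enormB {T : Type} (F : set_system T) {FF : Filter F}
    (f g : T -> 'rV[R]_n) x y :
  f @ F --> x -> g @ F --> y -> enorm (f k - g k) @[k --> F] --> enorm (x - y).
Proof. by move=> fx gy; apply: cvg_enorm; exact: cvgB. Qed.

Lemma closed_near A x : closed A -> ~ A x -> \forall y \near x, ~ A y.
Proof.
by move=> Acl nAx; apply: (open_nbhs_nbhs (A := ~` A)); split=> //; exact: closed_openC.
Qed.

(** Keeps the projections of all points near [x] in one bounded set, for a compactness argument. *)
Lemma norm_projset_le A x y a b : A a -> projset A y b ->
  enorm (y - a) <= enorm (x - a) + 1 -> `|y| <= `|x| + 1 -> `|b| <= enorm (x - a) + `|x| + 2.
Proof.
move=> Aa [_ /(_ a Aa) yb] ya yx.
have -> : b = y - (y - b) by rewrite opprB addrC subrK.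
rewrite (le_trans (ler_normB _ _))//; have := norm_le_enorm (y - b); lra.
Qed.

Lemma projset_self A a : A a -> projset A a = [set a].
Proof.
move=> Aa; apply/seteqP; split=> [b [_ /(_ a Aa)]|_ ->]; last first.
  by split=> // b _; rewrite subrr enorm0 enorm_ge0.
rewrite subrr enorm0 => ab; apply/esym/subr0_eq/enorm_eq0/eqP.
by rewrite eq_le ab enorm_ge0.
Qed.

Lemma projset_exists A x : A !=set0 -> closed A -> projset A x !=set0.
Proof.
move=> [a0 Aa0] Acl; pose K := A `&` [set b | enorm (x - b) <= enorm (x - a0)].
have fc : continuous (fun b => enorm (x - b)).
  by move=> b; exact: (cvg_enormB (cvg_cst x) (@cvg_id _ (nbhs b))).
have Kcl : closed K.
  apply: closedI => //; apply: (@closed_comp _ _ (fun b => enorm (x - b))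
    [set s | s <= enorm (x - a0)]) => [b _|]; [exact: fc|exact: closed_le].
have Kb : compact K.
  apply: bounded_closed_compact => //; exists (`|x| + enorm (x - a0)).
  split; first exact: num_real.
  move=> M /ltW xM b [_ /= xb]; have -> : b = x - (x - b) by rewrite opprB addrC subrK.
  rewrite (le_trans (ler_normB _ _))//; have := norm_le_enorm (x - b); lra.
have K0 : K !=set0 by exists a0; split=> //=.
have [a] := compact_EVT_min K0 Kb (continuous_subspaceT fc).
rewrite inE => -[Aa /= xa] amin; exists a; split=> // b Ab.
have [ba|/ltW ab] := leP (enorm (x - b)) (enorm (x - a0)); last exact: le_trans ab.
by apply: amin; rewrite inE.
Qed.

Lemma near_enorm_lt x a b : enorm (x - a) < enorm (x - b) ->
  \forall c \near b & y \near x, enorm (y - a) < enorm (y - c).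
Proof.
have Fa : enorm (i.2 - a) @[i --> filter_prod (nbhs b) (nbhs x)] --> enorm (x - a).
  refine (cvg_enormB (F := filter_prod (nbhs b) (nbhs x)) _ _);
    [exact: cvg_snd|exact: cvg_cst].
have Fb : enorm (i.2 - i.1) @[i --> filter_prod (nbhs b) (nbhs x)] --> enorm (x - b).
  refine (cvg_enormB (F := filter_prod (nbhs b) (nbhs x)) _ _);
    [exact: cvg_snd|exact: cvg_fst].
move=> xab; have [am mb] := midf_lt xab.
by apply: filterS2 (cvgr_lt _ Fa _ am) (cvgr_gt _ Fb _ mb) => i; exact: lt_trans.
Qed.

(** The points of [A] outside [interior U] and of norm at most [M] form a compact set, each of them
    strictly farther from [x] than [a] is. By compactness this persists for all [y] near [x], so no
    projection of such a [y] lies in that set. *)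
Lemma projset_usc A x a U : closed A -> projset A x = [set a] -> nbhs a U ->
  \forall y \near x, projset A y `<=` U.
Proof.
move=> Acl pxa Ua; have [Aa pa] : projset A x a by rewrite pxa.
pose M := enorm (x - a) + `|x| + 2.
pose K := A `&` ~` interior U `&` [set b | `|b| <= M].
have Kcl : closed K.
  apply: closedI; first by apply: closedI => //; exact/open_closedC/open_interior.
  apply: (@closed_comp _ _ (fun b : 'rV[R]_n => `|b|) [set s | s <= M]) => [b _|].
    exact: norm_continuous.
  exact: closed_le.
have Kc : compact K.
  apply: bounded_closed_compact => //; exists M; split; first exact: num_real.
  by move=> c /ltW Mc b [_ /= bM]; exact: le_trans Mc.
have cvgx : y @[y --> x] --> x by exact: cvg_id.
have far : \forall y \near x, K `<=` [set b | enorm (y - a) < enorm (y - b)].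
  apply: ((compact_near_coveringP K).1 Kc _ (nbhs x)
    (fun y b => enorm (y - a) < enorm (y - b))) => b [[Ab nUb] _].
  have xab : enorm (x - a) < enorm (x - b).
    rewrite lt_neqAle pa// andbT; apply/eqP => xab; apply: nUb.
    suff -> : b = a by [].
    have : projset A x b by split=> // c Ac; rewrite -xab pa.
    by rewrite pxa.
  exact: near_enorm_lt.
near=> y => b pb; apply: contrapT => nUb.
have : `|b| <= M.
  apply: (norm_projset_le Aa pb); apply: ltW; near: y.
    have : enorm (x - a) < enorm (x - a) + 1 by rewrite ltrDl.
    exact: (cvgr_lt _ (cvg_enormB cvgx (cvg_cst a))).
  have : `|x| < `|x| + 1 by rewrite ltrDl.
  exact: (cvgr_lt _ (cvg_norm cvgx)).
move=> bM; have : enorm (y - a) < enorm (y - b).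
  by apply: (near far y) => //; split=> //; split; [exact: pb.1|move/interior_subset].
by rewrite ltNge pb.2.
Unshelve. all: by end_near. Qed.

End Projections.

Lemma lt_ereal_between (R : realType) (t : R) (e : \bar R) : (t%:E < e)%E ->
  exists2 q, t < q & (q%:E < e)%E.
Proof.
case: e => [s||] //; last by exists (t + 1); rewrite ?ltrDl ?ltry.
by rewrite lte_fin => /midf_lt[tm ms]; exists ((t + s) / 2).
Qed.

(** * Persistence of missing spheres, and the passage from convexity to the sphere condition *)

Section Radius.
Context {R : realType} {n : nat}.
Variables (A : set 'rV[R]_n) (r : 'rV[R]_n -> \bar R).
Hypotheses (A_nonempty : A !=set0) (A_closed : closed A)
  (r_gt0 : forall a, bdry A a -> (0 < r a)%E)
  (r_cont : {within bdry A, continuous r}).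
Implicit Types (S U : set 'rV[R]_n) (a b x y z : 'rV[R]_n) (p q t : R).

Lemma bdry_sub : bdry A `<=` A.
Proof. by move/closure_id : A_closed => {2}->; exact: subDsetl. Qed.

(** For a unit [z] and [p] twice a radius, the inequality places [b] in the open ball; being strict,
    it survives small changes of normal and base point. *)
Lemma near_unrealized a b z p :
  dotp (b - a) (b - a) < p * dotp z (b - a) ->
  \forall z' \near z & a' \near a, dotp (b - a') (b - a') < p * dotp z' (b - a').
Proof.
have Fb : b - i.2 @[i --> filter_prod (nbhs z) (nbhs a)] --> b - a.
  by refine (cvgB _ _); [exact: cvg_cst|exact: cvg_snd].
have Fz : dotp i.1 (b - i.2) @[i --> filter_prod (nbhs z) (nbhs a)]
    --> dotp z (b - a).
  by refine (cvg_dotp _ Fb); exact: cvg_fst.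
have Fp : p * dotp i.1 (b - i.2) @[i --> filter_prod (nbhs z) (nbhs a)]
    --> p * dotp z (b - a).
  by refine (cvgM _ Fz); exact: cvg_cst.
move=> ab; have [am mb] := midf_lt ab.
by apply: filterS2 (cvgr_lt _ (cvg_dotp Fb Fb) _ am) (cvgr_gt _ Fp _ mb) => i;
  exact: lt_trans.
Qed.

Lemma radius_lsc a (e : \bar R) : bdry A a -> (e < r a)%E ->
  \forall b \near a, bdry A b -> (e < r b)%E.
Proof.
move=> ba era; have ra := (subspace_continuousP (bdry A) r).1 r_cont a ba.
exact: (ra [set y | (e < y)%E] (open_ereal_gt' era)).
Qed.

(** A ball of positive radius makes [z] a proximal normal, so at a boundary point this is the
    existence clause of the sphere condition. *)
Definition has_sphere a := exists2 z, enorm z = 1 & realized_ext A a z (r a).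

(** The failure is witnessed by a radius [p] strictly below [r a] and a point [b] of [A] in the ball
    of radius [p]. The former persists by lower semicontinuity of [r], the latter by
    [near_unrealized]. *)
Lemma near_not_realized_ext a z : bdry A a -> enorm z = 1 ->
  ~ realized_ext A a z (r a) ->
  \forall z' \near z & b \near a,
    enorm z' = 1 -> bdry A b -> ~ realized_ext A b z' (r b).
Proof.
move=> ba z1 nra.
have [p [p0 pr [b Ab pb]]] : exists p, [/\ 0 < p, (p%:E < r a)%E &
    exists2 b, A b & dotp (b - a) (b - a) < 2 * p * dotp z (b - a)].
  apply: contrapT => np; apply/nra/realized_extP => //; first exact: r_gt0.
  move=> p p0 pr; apply/realizedP => // [|b Ab]; first exact: ltW.
  by rewrite leNgt; apply/negP => pb; apply: np; exists p; split=> //; exists b.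
have Hr : \forall z' \near z & c \near a, bdry A c -> (p%:E < r c)%E.
  by exact: (@filter_prod2 _ _ (nbhs z) _ _ [set c | bdry A c -> (p%:E < r c)%E]
    (radius_lsc ba pr)).
apply: filterS2 (near_unrealized pb) Hr => -[z' c] /= pc pr' z'1 bc.
move=> /(realized_extP A c z'1 (r_gt0 bc)).1/(_ p p0 (pr' bc)).
by move=> /(realizedP A c z'1 (ltW p0)).1/(_ b Ab); rewrite leNgt pc.
Qed.

(** Compactness of the unit sphere makes the neighbourhood of [a] uniform in the direction. *)
Lemma near_not_has_sphere a : bdry A a -> ~ has_sphere a ->
  \forall b \near a, bdry A b -> ~ has_sphere b.
Proof.
move=> ba nga.
have H : \forall b \near a, [set z | enorm z = 1] `<=`
    [set z | enorm z = 1 -> bdry A b -> ~ realized_ext A b z (r b)].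
  apply: ((compact_near_coveringP _).1 unit_sphere_compact _ (nbhs a)
    (fun b z => enorm z = 1 -> bdry A b -> ~ realized_ext A b z (r b))) => w w1.
  by apply: near_not_realized_ext => // rw; apply: nga; exists w.
by apply: filterS H => b Hb bb [z z1]; exact: (Hb z z1 z1 bb).
Qed.

Lemma bdry_r_intP a : bdry A a ->
  bdry_r_int A r a <-> bdry (interior A) a /\ has_sphere a.
Proof.
move=> ba; split=> [[bia [z [_ z1] rz]]|[bia [z z1 rz]]]; split=> //; exists z => //.
- exact/(rho_ge_realized_ext A a z1 (r_gt0 ba)).
- split=> //; apply/prox_normal_realizedP => //; apply: realized_ext_gt0 rz.
  exact: r_gt0.
- exact/(rho_ge_realized_ext A a z1 (r_gt0 ba)).
Qed.

Lemma closed_bdry (B : set 'rV[R]_n) : closed (bdry B).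
Proof.
by apply: closedI; [exact: closed_closure|exact/open_closedC/open_interior].
Qed.

Lemma near_not_bdry_int a : ~ bdry (interior A) a ->
  \forall b \near a, ~ bdry (interior A) b.
Proof. by move=> nia; exact: (closed_near (@closed_bdry _) nia). Qed.

(** With [p] strictly between [enorm (x - a)] and [r a], one has
    [enorm (y - b) <= enorm (y - a) < p < r b]. *)
Lemma near_proj_radius x a : projset A x = [set a] -> bdry A a ->
  ((enorm (x - a))%:E < r a)%E ->
  \forall y \near x, forall b, projset A y b -> bdry A b ->
    ((enorm (y - b))%:E < r b)%E.
Proof.
move=> pxa ba xr; have [Aa _] : projset A x a by rewrite pxa.
have [p xp pr] := lt_ereal_between xr.
have Hr := projset_usc A_closed pxa (radius_lsc ba pr).
near=> y => b pb bb; apply: (lt_trans (y := p%:E)); last exact: (near Hr y).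
rewrite lte_fin (le_lt_trans (pb.2 a Aa))//; near: y.
exact: (cvgr_lt _ (cvg_enormB (@cvg_id _ (nbhs x)) (cvg_cst a)) _ xp).
Unshelve. all: by end_near. Qed.

Lemma Oset_open :
  (forall x, Oset A r x -> exists a, projset A x = [set a]) -> open (Oset A r).
Proof.
move=> uniq; rewrite openE => x Ox; have [a pxa] := uniq x Ox.
have [nAx [_ [/[!pxa] -> nia xr]]] := Ox.
have ba : bdry A a by apply: (@projset_bdry _ _ _ x) => //; rewrite pxa.
have Hn := closed_near A_closed nAx.
have Hi := projset_usc A_closed pxa (near_not_bdry_int nia).
have Hr := near_proj_radius pxa ba xr.
near=> y; have nAy : ~ A y by near: y.
have [b pb] := projset_exists y A_nonempty A_closed.
split=> //; exists b; split=> //; first exact: (near Hi y).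
by apply: (near Hr y) => //; exact: projset_bdry pb.
Unshelve. all: by end_near. Qed.

(** A point [a + q *: z] slightly beyond the maximal radius violates convexity: it lies in normal
    direction both from [a] and from a projection [b] of it, with both segments in [S], and [b] is
    not [a] because [q] is not realized. *)
Lemma max_radius_not_convex S a z p :
  A `<=` S ->
  (forall s, S s -> ~ A s -> exists2 b, projset A s b & segm b s `<=` S) ->
  A a -> enorm z = 1 -> 0 < p -> realized A a z p ->
  (forall q, p < q -> ~ realized A a z q) ->
  (forall t, 0 < t -> t <= p -> S (a + t *: z)) ->
  nbhs (a + p *: z) S -> ~ S_convex S A.
Proof.
move=> AS star Aa z1 p0 rp maxp Sz Sp Sconv.
have Hn := closed_near A_closed (realized_notin z1 p0 rp).
have [e e0 eS] := nbhs_eball_sub (filterI Sp Hn).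
pose q := p + e / 2; have q0 : 0 < q by rewrite /q; lra.
have inS t : p <= t -> t <= q -> S (a + t *: z) /\ ~ A (a + t *: z).
  move=> pt tq; apply: eS; rewrite /eball/= opprD addrACA subrr add0r -scalerBl.
  by rewrite enormZ z1 mulr1 ger0_norm ?subr_ge0//; move: tq; rewrite /q; lra.
have [Ss nAs] : S (a + q *: z) /\ ~ A (a + q *: z).
  by apply: inS; rewrite /q; lra.
have [b pb bS] := star _ Ss nAs.
have [w [u [Ab w1 u0 ru su]]] := projset_dir nAs pb.
have [||||||] := Sconv _ Ss nAs a b.
- exact: realized_bdry rp.
- exact: realized_bdry ru.
- move=> ab; apply: (maxp q); first by rewrite /q; lra.
  by move: pb; rewrite -ab => /(projset_ray A a z1 (ltW q0)).1[].
- apply/segm_ray => // t t0 tq; have [->|t1] := eqVneq t 0.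
    by rewrite scale0r addr0; exact: AS.
  have [tp|/ltW pt] := leP t p; last by have [] := inS t pt tq.
  by apply: Sz => //; rewrite lt_neqAle eq_sym t1.
- exact: bS.
- by apply; exact: (prox_normal_ray z1 p0 rp (ltW q0)).
- by apply; rewrite su; exact: (prox_normal_ray w1 u0 ru (ltW u0)).
Qed.

(** An abstract [S] serves both enlargements; uniqueness of the projection is asked only on the
    boundary of [S], as in (iii). *)
Lemma sphere_of_convex S :
  A `<=` S -> Oset A r `<=` S -> Pset A r `<=` S ->
  (forall s, S s -> ~ A s -> exists2 b, projset A s b & segm b s `<=` S) ->
  (forall x, S x -> ~ A x -> bdry S x -> exists a, projset A x = [set a]) ->
  open (Oset A r) -> S_convex S A -> ext_exterior_sphere A r.
Proof.
move=> AS OS PS star uniq Oopen Sconv.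
(* Up to the maximal radius the ray stays in the open set [Oset A r], so its end point is interior
   to [S]. *)
have outer a : bdry A a -> ~ bdry (interior A) a ->
    forall z, unit_prox_normal A a z -> realized_ext A a z (r a).
  move=> ba nia z uz; apply: contrapT => /(max_radius (r_gt0 ba) uz).
  move=> [p [p0 pr rp maxp]]; have [_ z1] := uz.
  have Aa := bdry_sub ba.
  have Oz t : 0 < t -> t <= p -> Oset A r (a + t *: z).
    move=> t0 tp; have rt : realized A a z t by apply: realized_le rp => //; exact: ltW.
    split; first exact: realized_notin rt.
    exists a; split=> //; first by apply/projset_ray => //; exact: ltW.
    by rewrite enorm_ray ?ltW// (le_lt_trans _ pr).
  apply: (max_radius_not_convex AS star Aa z1 p0 rp maxp) Sconv => [t t0 tp|].
    exact/OS/Oz.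
  by apply: filterS OS _; apply: open_nbhs_nbhs; split=> //; exact: Oz.
(* Without a sphere at [a], the ray up to the maximal radius lies in [Pset A r]. *)
have inner a z : bdry A a -> bdry (interior A) a ->
    unit_prox_normal A a z -> has_sphere a.
  move=> ba ia uz; apply: contrapT => nga; have [_ z1] := uz.
  have nrz : ~ realized_ext A a z (r a) by move=> rz; apply: nga; exists z.
  have [p [p0 pr rp maxp]] := max_radius (r_gt0 ba) uz nrz.
  have Aa := bdry_sub ba.
  have Pz t : 0 < t -> t <= p -> S (a + t *: z).
    move=> t0 tp; have rt : realized A a z t by apply: realized_le rp => //; exact: ltW.
    apply: PS; split; first exact: realized_notin rt.
    have pa : projset A (a + t *: z) a by apply/projset_ray => //; exact: ltW.
    by move=> /(_ a (conj pa ia)) /(bdry_r_intP ba).1[_].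
  have Sx := Pz p p0 (lexx p); have nAx := realized_notin z1 p0 rp.
  apply: (max_radius_not_convex AS star Aa z1 p0 rp maxp Pz) Sconv.
  (* An end point that is not interior to [S] projects onto [a] only. Nearby points then project
     near [a], where spheres are missing too, so they fall in [Pset A r] or [Oset A r], and the end
     point is interior after all. *)
  have [//|nSx] := pselect (nbhs (a + p *: z) S).
  have [a' pa'] : exists a', projset A (a + p *: z) = [set a'].
    by apply: uniq => //; split=> //; exact: subset_closure.
  have aa' : a = a'.
    have : projset A (a + p *: z) a by apply/projset_ray => //; exact: ltW.
    by rewrite pa'.
  rewrite -{}aa' in pa'.
  have Hn := closed_near A_closed nAx.
  have Hg := projset_usc A_closed pa' (near_not_has_sphere ba nga).
  have Hr : \forall y \near a + p *: z, forall b, projset A y b -> bdry A b ->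
      ((enorm (y - b))%:E < r b)%E.
    by apply: near_proj_radius pa' ba _; rewrite enorm_ray// ltW.
  near=> y; have nAy : ~ A y by near: y.
  have [b pb] := projset_exists y A_nonempty A_closed.
  have bb := projset_bdry nAy pb; have ngb : ~ has_sphere b by exact: (near Hg y).
  have [ib|nib] := pselect (bdry (interior A) b).
    apply: PS; split=> // /(_ b (conj pb ib)) /(bdry_r_intP bb).1[_].
    exact: ngb.
  by apply: OS; split=> //; exists b; split=> //; exact: (near Hr y).
move=> a ba; split=> [ia|]; last exact: outer.
have Aa := bdry_sub ba.
suff : has_sphere a.
  move=> [z z1 rz]; exists z => //; split=> //.
  by apply/prox_normal_realizedP => //; apply: realized_ext_gt0 rz; exact: r_gt0.
apply: contrapT => nga.
have Hg := projset_usc A_closed (projset_self Aa) (near_not_has_sphere ba nga).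
(* If there were no such [y], a whole neighbourhood of [a] would lie in [A]. A projection of [y] has
   a unit normal, which [a] may lack. *)
have [y nAy yg] : exists2 y, ~ A y & projset A y `<=` [set b | bdry A b -> ~ has_sphere b].
  apply: contrapT => ny; case: ba => _; apply; apply: filterS Hg => y yg.
  by apply: contrapT => nAy; apply: ny; exists y.
have [b pb] := projset_exists y A_nonempty A_closed.
have bb := projset_bdry nAy pb.
have [z [t [_ z1 t0 rt _]]] := projset_dir nAy pb.
have uz : unit_prox_normal A b z.
  by split=> //; apply/prox_normal_realizedP => //; exists t.
apply: (yg b pb bb); have [ib|nib] := pselect (bdry (interior A) b).
  exact: inner uz.
by exists z => //; exact: outer.
Unshelve. all: by end_near. Qed.

End Radius.

(** * Convexity and projections for the two enlargements of [A] *)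

Section Enlargements.
Context {R : realType} {n : nat}.
Variables (A : set 'rV[R]_n) (r : 'rV[R]_n -> \bar R).
Hypotheses (A_nonempty : A !=set0) (A_closed : closed A)
  (r_gt0 : forall a, bdry A a -> (0 < r a)%E).
Implicit Types (S U : set 'rV[R]_n) (a b s x y z : 'rV[R]_n) (p q t : R).

Lemma S_convexS S S' : S `<=` S' -> S_convex S' A -> S_convex S A.
Proof.
move=> SS' conv s Ss nAs a a' ba ba' aa' aS a'S.
by apply: conv => //; [exact: SS'|exact: subset_trans SS'|exact: subset_trans SS'].
Qed.

(** Otherwise the largest realized radius [p] is below the length of the segment, and [a + p *: z]
    lies on it outside [A], hence in [UPset A]. Its unique projection is [a], so a radius larger
    than [p] is realized. *)
Lemma projset_of_segm a s : A a -> ~ A s -> segm a s `<=` A `|` UPset A ->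
  prox_normal A a (s - a) -> projset A s a.
Proof.
move=> Aa nAs; have sa : s - a <> 0 by move/subr0_eq => sa; apply: nAs; rewrite sa.
have [d [z [d0 z1 ->]]] : exists d z, [/\ 0 < d, enorm z = 1 & s = a + d *: z].
  exists (enorm (s - a)), (normalized (s - a)); split.
  - exact: enorm_gt0.
  - exact: enorm_normalized.
  - by rewrite scale_normalized addrC subrK.
move=> /(segm_ray _ a z d0) aS za; apply/projset_ray => //; first exact: ltW.
have {}za : prox_normal A a z.
  have := prox_normalZ (t := d^-1) _ za; rewrite addrAC subrr add0r scalerA.
  by rewrite mulVf ?gt_eqF// scale1r; apply; rewrite invr_ge0 ltW.
split=> //; apply: contrapT => nrd.
have [|p [p0 pd rp maxp]] := @max_radius _ _ A a z d%:E _ (conj za z1) nrd.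
  by rewrite lte_fin.
rewrite lte_fin in pd.
have [/(realized_notin z1 p0 rp)//|] := aS p (ltW p0) (ltW pd).
move=> /UPsetP[b [w [t [q [[Ab w1] t0 tq rq ab]]]]].
have : projset A (a + p *: z) a by apply/projset_ray => //; exact: ltW.
rewrite ab (projset_ray_uniq w1 Ab (ltW t0) tq rq) /= => aEb.
move: ab; rewrite -aEb => /addrI zw.
have pt : p = t by rewrite -(enorm_ray a z1 (ltW p0)) zw enorm_ray// ltW.
apply: (maxp q); first by rewrite pt.
move: zw; rewrite pt => /scalerI ->; first by rewrite aEb.
by rewrite gt_eqF.
Qed.

(** By [projset_of_segm] both base points would be projections of [s], which has only one. *)
Lemma convex_of_UPset S : S `<=` A `|` UPset A -> S_convex S A.
Proof.
move=> SU; apply: (S_convexS SU) => s Us nAs a a' ba ba' aa' aS a'S.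
have [//|[_ [b [pb _]]]] := Us.
have [na|] := pselect (prox_normal A a (s - a)); last by left.
right=> na'; apply: aa'.
have := projset_of_segm (bdry_sub A_closed ba) nAs aS na.
have := projset_of_segm (bdry_sub A_closed ba') nAs a'S na'.
by rewrite pb => -> ->.
Qed.

Lemma projset_segm_sub x a S : A `|` UPset A `<=` S -> S x -> ~ A x ->
  projset A x a -> segm a x `<=` S.
Proof.
move=> US Sx nAx /(projset_dir nAx)[z [t [Aa z1 t0 rt xE]]].
rewrite xE; apply/segm_ray => // c; rewrite le_eqVlt => /predU1P[<- _|c0].
  by rewrite scale0r addr0; apply: US; left.
rewrite le_eqVlt => /predU1P[->|ct]; first by rewrite -xE.
by apply: US; right; apply/UPsetP; exists a, z, c, t.
Qed.

(** Two distinct projections would contradict convexity at [x] itself: both directions are normal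
    and both segments stay in the enlargement. *)
Lemma Abar_upper_uniq x : S_convex (Abar_upper A r) A -> Abar_upper A r x ->
  ~ A x -> exists a, projset A x = [set a].
Proof.
move=> conv Sx nAx; have [a pa] := projset_exists x A_nonempty A_closed.
have US : A `|` UPset A `<=` Abar_upper A r by move=> y; left; left.
have normal b : projset A x b -> prox_normal A b (x - b).
  move=> /(projset_dir nAx)[z [t [Ab z1 t0 rt ->]]].
  exact: (prox_normal_ray z1 t0 rt (ltW t0)).
exists a; apply/seteqP; split=> [b pb|_ -> //]; apply: contrapT => ba.
have [|||||na|na] := conv x Sx nAx b a.
- exact: projset_bdry pb.
- exact: projset_bdry pa.
- exact: ba.
- exact: projset_segm_sub pb.
- exact: projset_segm_sub pa.
- exact/na/normal.
- exact/na/normal.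
Qed.

(** The projection to take is the one witnessing that [x] belongs to its piece; it is also a witness
    for every other point of the segment outside [A]. *)
Lemma Abar_lower_projset_segm x : Abar_lower A r x -> ~ A x ->
  exists2 b, projset A x b & segm b x `<=` Abar_lower A r.
Proof.
move=> Lx nAx.
have segmI b : projset A x b -> (forall z c, enorm z = 1 -> 0 < c ->
      c <= enorm (x - b) -> realized A b z c -> Abar_lower A r (b + c *: z)) ->
    exists2 b, projset A x b & segm b x `<=` Abar_lower A r.
  move=> pb H; exists b => //; have [z [t [Ab z1 t0 rt xE]]] := projset_dir nAx pb.
  rewrite xE; apply/segm_ray => // c; rewrite le_eqVlt => /predU1P[<- _|c0 ct].
    by rewrite scale0r addr0; left; left; left.
  apply: H => //; first by rewrite xE enorm_ray// ltW.
  by apply: realized_le rt => //; exact: ltW.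
case: Lx => [[[//|]|]|].
- move=> /UPset_rP[a [z [t [q [[Aa z1] [t0 tq] qr rq xE]]]]].
  exists a; first by rewrite xE (projset_ray_uniq z1 Aa (ltW t0) tq rq).
  rewrite xE; apply/segm_ray => // c; rewrite le_eqVlt => /predU1P[<- _|c0 ct].
    by rewrite scale0r addr0; left; left; left.
  left; left; right; apply/UPset_rP; exists a, z, c, q; split=> //.
  by split=> //; exact: le_lt_trans tq.
- move=> [_ [a [pa nia xr]]]; apply: (segmI a) => //.
  move=> z c z1 c0 cx rc; left; right; split; first exact: realized_notin rc.
  exists a; split=> //.
    by apply/projset_ray => //; [exact: ltW|split=> //; exact: pa.1].
  by rewrite enorm_ray ?(ltW c0)// (le_lt_trans _ xr).
- move=> [_ /existsNP[a /not_implyP[[pa ia] nga]]].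
  apply: (segmI a) => //.
  move=> z c z1 c0 cx rc; right; split; first exact: realized_notin rc.
  have ca : projset A (a + c *: z) a.
    by apply/projset_ray => //; [exact: ltW|split=> //; exact: pa.1].
  by move=> /(_ a (conj ca ia)).
Qed.

Lemma UPset_r_sub : UPset_r A r `<=` UPset A.
Proof.
move=> x /UPset_rP[a [z [t [q [az [t0 tq] _ rq xE]]]]].
by apply/UPsetP; exists a, z, t, q.
Qed.

Hypothesis sphere : ext_exterior_sphere A r.

Lemma Pset_eq0 x : ~ Pset A r x.
Proof.
move=> [nAx]; apply=> a [pa ia]; have ba := projset_bdry nAx pa.
split=> //; have [z uz rz] := (sphere ba).1 ia.
by exists z => //; apply/rho_ge_realized_ext => //; [case: uz|exact: r_gt0].
Qed.

(** The direction of [x] from [a] is realized at every radius below [r a], in particular at one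
    exceeding the distance to [x]. *)
Lemma Oset_sub : Oset A r `<=` UPset A.
Proof.
move=> x [nAx [a [pa nia xr]]]; have ba := projset_bdry nAx pa.
have [z [t [Aa z1 t0 rt xE]]] := projset_dir nAx pa.
have uz : unit_prox_normal A a z.
  by split=> //; apply/prox_normal_realizedP => //; exists t.
have rz := (sphere ba).2 nia z uz.
have tr : (t%:E < r a)%E by rewrite -(enorm_ray a z1 (ltW t0)) -xE.
have [q tq qr] := lt_ereal_between tr.
apply/UPsetP; exists a, z, t, q; split=> //.
by apply: (realized_extP A a z1 (r_gt0 ba)).1 => //; lra.
Qed.


End Enlargements.

Theorem theorem4p2 (R : realType) (n : nat) (A : set 'rV[R]_n)
    (r : 'rV[R]_n -> \bar R)
    (A_nonempty : A !=set0) (A_closed : closed A)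
    (r_gt0 : forall a, bdry A a -> (0 < r a)%E)
    (r_cont : {within bdry A, continuous r}) :
  (ext_exterior_sphere A r <-> S_convex (Abar_upper A r) A) /\
  (S_convex (Abar_upper A r) A <->
     [/\ S_convex (Abar_lower A r) A,
         forall x, Abar_lower A r x -> bdry (Abar_lower A r) x ->
           exists a, projset A x = [set a]
       & open (Oset A r)]).
Proof.
have sphere_upper : ext_exterior_sphere A r -> S_convex (Abar_upper A r) A.
  move=> sphere; apply: convex_of_UPset => // x [[|]|].
  - by [].
  - by move=> /(Oset_sub r_gt0 sphere); right.
  - by move=> /(Pset_eq0 r_gt0 sphere).
have upper_sphere : S_convex (Abar_upper A r) A -> ext_exterior_sphere A r.
  move=> conv; have uniq x := Abar_upper_uniq A_nonempty A_closed conv (x := x).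
  apply: (sphere_of_convex A_nonempty A_closed r_gt0 r_cont _ _ _ _ _ _ conv).
  - by move=> x; left; left; left.
  - by move=> x; left; right.
  - by move=> x; right.
  (* Any projection will do, since the segment to it stays in [A] and [UPset A] except perhaps at
     [x]. *)
  - move=> x Sx nAx; have [a pa] := projset_exists x A_nonempty A_closed.
    by exists a => //; apply: projset_segm_sub pa => // y; left; left.
  - by move=> x Sx nAx _; exact: uniq.
  - apply: Oset_open => // x Ox; apply: uniq; first by left; right.
    by case: Ox.
split; first by split.
split=> [/upper_sphere sphere|[conv uniq Oopen]].
  (* This inclusion gives the convexity and, a point of [A] being its own projection, the
     uniqueness. *)
  have LU : Abar_lower A r `<=` A `|` UPset A.
    move=> x [[[|/UPset_r_sub]|/(Oset_sub r_gt0 sphere)]|]; [by left|by right|by right|].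
    by move=> /(Pset_eq0 r_gt0 sphere).
  split.
  - exact: convex_of_UPset.
  - by move=> x /LU[/projset_self xx|[_ [a [pa _]]]] _; [exists x|exists a].
  - by apply: Oset_open => // x /(Oset_sub r_gt0 sphere)[_ [a [pa _]]]; exists a.
(* Assertion (iii) returns to (ii) by way of (i). *)
apply: sphere_upper.
apply: (sphere_of_convex A_nonempty A_closed r_gt0 r_cont _ _ _ _ _ _ conv) => //.
- by move=> x; left; left; left.
- by move=> x; left; right.
- by move=> x; right.
- exact: Abar_lower_projset_segm.
- by move=> x Sx _; exact: uniq.
Qed.
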